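(* Let $f$ be a simplicial harmonic map of a connected metrized triangulated compact surface $(F,\tau,l)$ into $\mathbb{R}^n$. Let $v$ be a vertex of $\tau$, let $D$ be the closed star of $v$ (the union of all the simplices of $\tau$ which contain $v$), and let $v_1,\ldots,v_k$ denote the other vertices of $D$. Then $f(v)$ lies in the convex hull of $f(v_1),\ldots,f(v_k)$. Further, $f(v)$ is the centre of mass of a collection of positive weights placed at $f(v_1),\ldots,f(v_k)$.
   Context: Triangulations. A triangulation $\tau$ of a compact surface $F$ is a $\Delta$-complex structure: $F$ is obtained from a disjoint union of triangles with ordered vertices by order-preserving identifications of faces. The minimal vertex of each simplex is its preferred vertex. Metrics. A simplicial metric $l$ on $(F,\tau)$ assigns to each edge $e_i$ a length $l_i=l(e_i)>0$ so that the (non-strict) triangle inequalities hold for each triangle. A metrized triangulated surface $(F,\tau,l)$ is one equipped with such an $l$. Energy. For a map $f$ from $F$ to a Riemannian manifold, rectifiable on edges, $L_i$ is the length of $f|e_i$, $\sigma_i=L_i/l_i$, and $$E_S(f)=\frac12\sum_{T\in\tau}\left[(\sigma_i^2+\sigma_j^2)l_il_j+(\sigma_j^2+\sigma_k^2)l_jl_k+(\sigma_k^2+\sigma_i^2)l_kl_i\right],$$ the sum being over triangles $T$ of $\tau$ with edge lengths $l_i,l_j,l_k$. Simplicial maps. Each triangle is identified with the Euclidean triangle with the same edge lengths, with the cone structure whose cone point is its preferred vertex. A map is simplicial if each edge of $\tau$ and each cone line in each triangle is mapped as a (constant speed, possibly constant) geodesic arc. Harmonic. A variation of $f$ is a 1-parameter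 family of maps $f_t$, $-\epsilon<t<\epsilon$, with $f_0=f$. If $F$ is closed, $f$ is simplicial harmonic if it is simplicial and is a critical point of $E_S$ under all variations of $f$. If $F$ is compact with non-empty boundary, $f$ is simplicial harmonic if it is simplicial and is a critical point of $E_S$ under all variations of $f$ which leave $\partial F$ fixed.
   Formalization: The vertex v is assumed not to lie on the boundary of F (boundary vertices are fixed, and the claim fails on a single triangle), and the triangulation is assumed to have a vertex other than v (otherwise the list v_1,…,v_k is empty). *)

(* Defs.v *)
From HB Require Import structures.
From mathcomp Require Import all_boot all_order all_algebra.
From mathcomp Require Import all_classical all_reals all_analysis.

Set Implicit Arguments.
Unset Strict Implicit.
Unset Printing Implicit Defensive.

Import Order.TTheory GRing.Theory Num.Theory.
Import numFieldNormedType.Exports.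

Local Open Scope classical_set_scope.
Local Open Scope ring_scope.

Section Surfaces.

Definition homeomorphic_sets (X Y : topologicalType) (A : set X) (B : set Y) :=
  exists (g : X -> Y) (h : Y -> X),
    [/\ {within A, continuous g}, {within B, continuous h},
        forall x, A x -> B (g x) /\ h (g x) = x
      & forall y, B y -> A (h y) /\ g (h y) = y].

Variables (R : realType) (F : topologicalType).

Definition half_plane : set 'rV[R]_2 := [set x | 0 <= x 0 1].

(* Compact 2-manifold, possibly with boundary. *)
Definition compact_surface :=
  [/\ compact [set: F], hausdorff_space F, @second_countable F
    & forall p : F, exists (U : set F) (W : set 'rV[R]_2),
        [/\ open U, U p, open W & homeomorphic_sets U (W `&` half_plane)]].

Definition surface_interior : set F :=
  [set p | exists (U : set F) (W : set 'rV[R]_2),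
     [/\ open U, U p, open W & homeomorphic_sets U W]].

Definition surface_boundary : set F := ~` surface_interior.

End Surfaces.

Section Simplices.
Variables (R : realType) (k : nat).

Definition std_simplex : set 'rV[R]_k.+1 :=
  [set x | (forall i, 0 <= x 0 i) /\ \sum_i x 0 i = 1].

Definition open_std_simplex : set 'rV[R]_k.+1 :=
  [set x | (forall i, 0 < x 0 i) /\ \sum_i x 0 i = 1].

Definition corner (i : 'I_k.+1) : 'rV[R]_k.+1 := delta_mx 0 i.

(* The order-preserving affine inclusion of the standard k-simplex as the face
   of the standard (k+1)-simplex opposite to the i-th corner. *)
Definition coface (i : 'I_k.+2) (x : 'rV[R]_k.+1) : 'rV[R]_k.+2 :=
  \row_j oapp (x 0) 0 (unlift i j).

End Simplices.

(* A 2-dimensional Delta-complex structure on F.  The corners of each simplex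
   are ordered by their index; corner 0 is the preferred vertex.  Different
   faces of one simplex may be glued, so cell s need not be injective on the
   closed simplex.  Finiteness is no restriction, since F will be compact.
   By simp_bij and simp_open, F has the quotient topology and is the quotient
   of the disjoint union of the triangles by the identifications of faces
   recorded by face; by simp_face0 and simp_face1 the triangles suffice. *)
Record triangulation (R : realType) (F : topologicalType) := Triangulation {
  simp : nat -> finType;
  cell : forall k : nat, simp k -> 'rV[R]_k.+1 -> F;
  face : forall k : nat, 'I_k.+2 -> simp k.+1 -> simp k;
  cell_face : forall (k : nat) (i : 'I_k.+2) (s : simp k.+1) (x : 'rV[R]_k.+1),
    std_simplex x -> cell (face i s) x = cell s (coface i x);
  simp_bij : forall p : F, exists! c : {k : nat & (simp k * 'rV[R]_k.+1)%type},
    open_std_simplex (tagged c).2 /\ cell (tagged c).1 (tagged c).2 = p;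
  simp_open : forall U : set F,
    open U <-> forall (k : nat) (s : simp k), exists2 W : set 'rV[R]_k.+1,
      open W & cell s @^-1` U `&` @std_simplex R k = W `&` @std_simplex R k;
  simp_dim : forall k : nat, #|simp k.+3| = 0%N;
  simp_face0 : forall v : simp 0, exists (i : 'I_2) (e : simp 1), face i e = v;
  simp_face1 : forall e : simp 1, exists (i : 'I_3) (t : simp 2), face i t = e
}.

Section Paths.
Variables (R : realType) (n : nat).

(* The norm that MathComp-Analysis puts on 'rV[R]_n is the sup norm. *)
Definition euclid_norm (x : 'rV[R]_n) : R := Num.sqrt (\sum_i x 0 i ^+ 2).

Definition segment (x y : 'rV[R]_n) (s : R) : 'rV[R]_n :=
  (1 - s) *: x + s *: y.

(* Length of a path parametrised by [0, 1]. *)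
Definition path_length (g : R -> 'rV[R]_n) : \bar R :=
  ereal_sup [set (\sum_(0 <= i < size s)
      euclid_norm (g (nth 1 (0 :: s) i.+1) - g (nth 1 (0 :: s) i)))%:E
    | s in itv_partition 0 1].

(* In Euclidean space the geodesic arcs of constant (possibly zero) speed are
   the affine paths. *)
Definition geodesic_arc (g : R -> 'rV[R]_n) :=
  forall s : R, 0 <= s <= 1 -> g s = segment (g 0) (g 1) s.

End Paths.

Section Harmonic.
Variables (R : realType) (F : topologicalType) (tau : triangulation R F).
Implicit Types (l : simp tau 1 -> R) (v w : simp tau 0).

Definition simplicial_metric l :=
  (forall e, 0 < l e) /\
  (forall (t : simp tau 2) (i : 'I_3),
     l (face i t) <= \sum_(j | j != i) l (face j t)).

Definition vertex_point v : F := cell v (corner R 0).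

Section Maps.
Variable n : nat.
Implicit Types f : F -> 'rV[R]_n.

Definition edge_path f (e : simp tau 1) (s : R) : 'rV[R]_n :=
  f (cell e (segment (corner R 0) (corner R 1) s)).

Definition rectifiable_on_edges f :=
  forall e, (path_length (edge_path f e) < +oo)%E.

Definition edge_length f (e : simp tau 1) : R :=
  fine (path_length (edge_path f e)).

Definition stretch l f (e : simp tau 1) : R := edge_length f e / l e.

Definition energy l f : R :=
  2^-1 * \sum_(t : simp tau 2) \sum_(i < 3) \sum_(j < 3 | (i < j)%N)
    (stretch l f (face i t) ^+ 2 + stretch l f (face j t) ^+ 2)
      * l (face i t) * l (face j t).

(* A triangle is identified with the Euclidean triangle of the same edge
   lengths by the affine map matching their corners.  The cone lines are thus
   the segments from corner 0 to the points x of the opposite edge, and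
   constant speed along a cone line may be tested in the standard simplex;
   this is why the metric does not occur here. *)
Definition simplicial_map f :=
  [/\ continuous f,
      forall e, geodesic_arc (edge_path f e)
    & forall (t : simp tau 2) (x : 'rV[R]_3), std_simplex x -> x 0 0 = 0 ->
        geodesic_arc (fun s => f (cell t (segment (corner R 0) x s)))].

(* Only the maps h t with |t| < eps matter. *)
Definition variation_of f (eps : R) (h : R -> F -> 'rV[R]_n) :=
  [/\ 0 < eps, h 0 = f,
      {within [set p : R * F | `|p.1| < eps],
        continuous (fun p : R * F => h p.1 p.2)}
    & forall t, `|t| < eps -> rectifiable_on_edges (h t)].

Definition fixes_boundary f (eps : R) (h : R -> F -> 'rV[R]_n) :=
  forall t p, `|t| < eps -> surface_boundary R p -> h t p = f p.

(* If F is closed its boundary is empty and fixes_boundary is vacuous.  The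
   derivative of the energy at t = 0 vanishes whenever it exists; it does not
   exist for every continuous variation. *)
Definition simplicial_harmonic l f :=
  simplicial_map f /\
  forall (eps : R) (h : R -> F -> 'rV[R]_n),
    variation_of f eps h -> fixes_boundary f eps h ->
    derivable (fun t : R => energy l (h t)) 0 1 ->
    'D_1 (fun t : R => energy l (h t)) 0 = 0.

End Maps.

Definition closed_cell (k : nat) (s : simp tau k) : set F :=
  cell s @` @std_simplex R k.

Definition closed_star v : set F :=
  [set p | exists (k : nat) (s : simp tau k),
     closed_cell s (vertex_point v) /\ closed_cell s p].

Definition other_star_vertex v w : bool :=
  (w != v) && `[< closed_star v (vertex_point w) >].

End Harmonic.

Definition convex_hull (R : realType) (n : nat) (A : set 'rV[R]_n) :
    set 'rV[R]_n :=
  smallest (@convex_set R 'rV[R]_n) A.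

(* Main.v *)
Require Import Defs.
From HB Require Import structures.
From mathcomp Require Import all_boot all_order all_algebra.
From mathcomp Require Import all_classical all_reals all_analysis.
From mathcomp Require Import ring lra.

Set Implicit Arguments.
Unset Strict Implicit.
Unset Printing Implicit Defensive.

Import Order.TTheory GRing.Theory Num.Theory.
Import numFieldNormedType.Exports.

Local Open Scope classical_set_scope.
Local Open Scope ring_scope.

(** Move f(v) in a direction a, dragging along only what lies close to v.  The
    energy is a sum over the edges of positive multiples of squared lengths:
    collecting the terms of each triangle by edge gives
    E_S(f) = sum_e w_e L_e^2 with w_e > 0 (energyE, energy_weight_gt0).  The
    derivative of L_e^2 at time 0 is twice the inner product of the edge vector
    f(end) - f(start) with the difference of the velocities of the two ends, so
    criticality says that the vectors w_e (f(v) - f(w)), over the edges e from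
    v to some w <> v, add up to zero (harmonic_balance).  This is the equality
    f(v) = centre of mass of the f(w), the weight at w being the sum of the w_e
    over the edges from v to w.

    Three points need an argument.

    The variation must fix the boundary of F.  The obvious velocity, the
    barycentric coordinate of v, is non-zero on the whole open star, and it
    would have to be shown that the open star avoids the boundary.  Instead, the
    barycentric coordinate x at each corner that lies at v is replaced by
    max(0, x - c) with a constant c < 1 (hat_function, interior_vertex_bump).
    For c close to 1 this vanishes outside a given neighbourhood of v
    (corner_cap), and v has a neighbourhood of interior points.

    With such a velocity the edges get bent, and their lengths have no simple
    formula.  They are only needed to first order.  The squared length of a path
    is at least that of its chord and at most its energy, and for the path
    s |-> p + s (q - p) + t psi(s) a these two are quadratic polynomials in t
    with the same 1-jet at t = 0 (perturbed_segment_length).  A function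
    squeezed between two such polynomials is differentiable
    (derive_quadratic_remainder).

    Finally the star of v must contain a second vertex.  Otherwise the
    barycentric coordinate of v is a continuous function on F with values 0 and
    1 only, and both values occur (exists_other_star_vertex). *)

(** * Lengths of paths in Euclidean space *)

Section EuclideanPaths.
Variables (R : realType) (n : nat).
Implicit Types (x y a : 'rV[R]_n) (g : R -> 'rV[R]_n) (G : R -> R).

Definition dot x y : R := \sum_i x 0 i * y 0 i.

Lemma euclid_norm_ge0 x : 0 <= euclid_norm x.
Proof. exact: sqrtr_ge0. Qed.

Lemma dot_ge0 x : 0 <= dot x x.
Proof. by apply: sumr_ge0 => i _; rewrite -expr2 sqr_ge0. Qed.

Lemma sqr_euclid_norm x : euclid_norm x ^+ 2 = dot x x.
Proof.
have -> : euclid_norm x = Num.sqrt (dot x x).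
  by congr Num.sqrt; apply: eq_bigr => i _; rewrite expr2.
by rewrite sqr_sqrtr // dot_ge0.
Qed.

Lemma dot_eq0 x : dot x x = 0 -> x = 0.
Proof.
move=> x0; apply/rowP => i; rewrite mxE.
have sq_ge0 j : true -> 0 <= x 0 j * x 0 j by rewrite -expr2 sqr_ge0.
have := psumr_eq0P sq_ge0 x0 (i := i) isT.
by move/eqP; rewrite mulf_eq0 orbb => /eqP.
Qed.

Lemma dotDl x y z : dot (x + y) z = dot x z + dot y z.
Proof. by rewrite -big_split; apply: eq_bigr => i _; rewrite mxE mulrDl. Qed.

Lemma dotZl k x y : dot (k *: x) y = k * dot x y.
Proof. by rewrite mulr_sumr; apply: eq_bigr => i _; rewrite mxE mulrA. Qed.

Lemma dotC x y : dot x y = dot y x.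
Proof. by apply: eq_bigr => i _; rewrite mulrC. Qed.

Lemma dot_suml (I : finType) (u : I -> 'rV[R]_n) y :
  dot (\sum_i u i) y = \sum_i dot (u i) y.
Proof.
rewrite /dot exchange_big; apply: eq_bigr => i _.
by rewrite summxE mulr_suml.
Qed.

Lemma dot_comb (r k : R) x y :
  dot (r *: x + k *: y) (r *: x + k *: y) =
  r ^+ 2 * dot x x + 2 * r * k * dot x y + k ^+ 2 * dot y y.
Proof.
rewrite dotDl !dotZl [dot x _]dotC [dot y _]dotC !dotDl !dotZl [dot y x]dotC.
by ring.
Qed.

(** The geometric mean is superadditive: this is Cauchy-Schwarz for the
    vectors (sqrt A, sqrt C) and (sqrt B, sqrt D), written with squares to
    avoid the roots. *)
Lemma sqr_le_prodD (p q A B C D : R) :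
  0 <= A -> 0 <= B -> 0 <= C -> 0 <= D -> 0 <= p -> 0 <= q ->
  p ^+ 2 <= A * B -> q ^+ 2 <= C * D -> (p + q) ^+ 2 <= (A + C) * (B + D).
Proof.
move=> A0 B0 C0 D0 p0 q0 pAB qCD.
suff : 2 * (p * q) <= A * D + C * B by nra.
rewrite -(@ler_pXn2r _ 2) ?nnegrE ?addr_ge0 ?mulr_ge0 //.
have pqle : p ^+ 2 * q ^+ 2 <= (A * B) * (C * D) by rewrite ler_pM ?sqr_ge0.
have := sqr_ge0 (A * D - C * B); nra.
Qed.

(** G r plays the role of the energy of g up to time r.  A bound of squared
    lengths by products of increments of time and of G survives concatenation,
    because the geometric mean is superadditive. *)
Lemma sqr_path_sum_le g G (x y : R) (s : seq R) :
  (forall r r', x <= r -> r < r' -> r' <= y ->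
     dot (g r' - g r) (g r' - g r) <= (r' - r) * (G r' - G r)) ->
  itv_partition x y s ->
  (\sum_(0 <= i < size s)
     euclid_norm (g (nth y (x :: s) i.+1) - g (nth y (x :: s) i))) ^+ 2
  <= (y - x) * (G y - G x) /\ G x <= G y.
Proof.
elim: s x => [|z s IH] x gG [/=].
  by move=> _ /eqP <-; rewrite big_geq // expr0n subrr mul0r lexx.
move=> /andP[xz zs] lasts.
have zsP : itv_partition z y s by [].
have zy := itv_partition_le zsP.
have [||IHs Gzy] := IH z.
- by move=> r r' zr; apply: gG; rewrite (le_trans (ltW xz)).
- by split.
have gxz := gG _ _ (lexx x) xz zy.
have Gxz : G x <= G z.
  rewrite -subr_ge0 -(@pmulr_rge0 _ (z - x)) ?subr_gt0 //.
  exact: le_trans (dot_ge0 _) gxz.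
split; last exact: le_trans Gzy.
rewrite big_nat_recl //= -(subrKA z y) -(subrKA (G z) (G y)).
rewrite [(y - z) + _]addrC [(G y - G z) + _]addrC.
apply: sqr_le_prodD; rewrite ?subr_ge0 ?(ltW xz) ?euclid_norm_ge0 //.
- by apply: sumr_ge0 => i _; exact: euclid_norm_ge0.
- by rewrite sqr_euclid_norm.
Qed.

(** The chord is the sum over the trivial partition; the upper bound is the
    inequality between squared length and energy. *)
Lemma path_length_bounds g G :
  (forall r r', 0 <= r -> r < r' -> r' <= 1 ->
     dot (g r' - g r) (g r' - g r) <= (r' - r) * (G r' - G r)) ->
  [/\ (path_length g < +oo)%E,
      dot (g 1 - g 0) (g 1 - g 0) <= fine (path_length g) ^+ 2 &
      fine (path_length g) ^+ 2 <= G 1 - G 0].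
Proof.
move=> gG.
have G0 : 0 <= G 1 - G 0.
  by have := gG 0 1 (lexx _) ltr01 (lexx _); rewrite subr0 mul1r;
     exact: le_trans (dot_ge0 _).
have ub : (path_length g <= (Num.sqrt (G 1 - G 0))%:E)%E.
  apply: ge_ereal_sup => _ [s /(sqr_path_sum_le gG)[sle _] <-].
  rewrite lee_fin -(@ler_pXn2r _ 2) ?nnegrE ?sqrtr_ge0 //; last first.
    by apply: sumr_ge0 => i _; exact: euclid_norm_ge0.
  by rewrite sqr_sqrtr // (le_trans sle) // subr0 mul1r.
have lb : ((euclid_norm (g 1 - g 0))%:E <= path_length g)%E.
  apply: ereal_sup_ubound; exists [:: 1]; first by exact: itv_partition1.
  by rewrite /= big_nat1.
have fin : path_length g \is a fin_num.
  by rewrite fin_numE; apply/andP; split; apply/eqP => e;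
     move: ub lb; rewrite e // leeNy_eq.
move: ub lb; rewrite -(fineK fin) !lee_fin ltry.
set L := fine _ => ub lb; split=> //.
- by rewrite -sqr_euclid_norm ler_pXn2r // nnegrE ?euclid_norm_ge0 //
             (le_trans _ lb) ?euclid_norm_ge0.
- rewrite -[leRHS]sqr_sqrtr // ler_pXn2r // nnegrE ?sqrtr_ge0 //.
  by rewrite (le_trans _ lb) ?euclid_norm_ge0.
Qed.

(** The lower bound is the squared chord with the term in t ^+ 2 discarded, the
    upper one is a bound for the energy.  They agree to first order in t
    although psi may have corners, because the mixed term of the energy
    depends on psi through psi 1 - psi 0 only. *)
Lemma perturbed_segment_length (p q a : 'rV[R]_n) (psi : R -> R) (Lam t : R) g :
  (forall s, 0 <= s <= 1 -> g s = segment p q s + (t * psi s) *: a) ->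
  (forall r r', 0 <= r -> r <= r' -> r' <= 1 -> `|psi r' - psi r| <= Lam * (r' - r)) ->
  let lin := dot (q - p) (q - p) + t * (2 * (psi 1 - psi 0) * dot (q - p) a) in
  [/\ (path_length g < +oo)%E,
      lin <= fine (path_length g) ^+ 2 &
      fine (path_length g) ^+ 2 <= lin + t ^+ 2 * (Lam ^+ 2 * dot a a)].
Proof.
move=> gE psiL lin.
(* For a Lipschitz psi, G s - G 0 majorises the integral from 0 to s of the squared
   speed of g. *)
pose G s := s * dot (q - p) (q - p) + t * (2 * psi s * dot (q - p) a)
            + s * (t ^+ 2 * (Lam ^+ 2 * dot a a)).
have dg r r' : 0 <= r -> r <= r' -> r' <= 1 ->
    g r' - g r = (r' - r) *: (q - p) + (t * (psi r' - psi r)) *: a.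
  move=> r0 rr' r1; rewrite !gE ?r0 ?r1 ?(le_trans r0) ?(le_trans rr') //.
  by apply/rowP => i; rewrite !mxE; ring.
have gG r r' : 0 <= r -> r < r' -> r' <= 1 ->
     dot (g r' - g r) (g r' - g r) <= (r' - r) * (G r' - G r).
  move=> r0 rr' r1; rewrite (dg _ _ r0 (ltW rr') r1) dot_comb /G.
  have sq : (psi r' - psi r) ^+ 2 <= Lam ^+ 2 * (r' - r) ^+ 2.
    rewrite -exprMn -[leLHS]real_normK ?num_real // ler_pXn2r ?nnegrE //.
      exact: psiL (ltW rr') r1.
    exact: le_trans (psiL _ _ r0 (ltW rr') r1).
  rewrite -subr_ge0.
  set k := t ^+ 2 * dot a a.
  have : 0 <= k * (Lam ^+ 2 * (r' - r) ^+ 2 - (psi r' - psi r) ^+ 2).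
    by rewrite mulr_ge0 ?subr_ge0 // mulr_ge0 ?sqr_ge0 ?dot_ge0.
  by move/le_trans; apply; rewrite le_eqVlt; apply/orP; left;
     apply/eqP; rewrite /k; ring.
have [Lfin Llb Lub] := path_length_bounds gG.
split=> //.
- apply: le_trans Llb; rewrite dg // subr0 dot_comb /lin.
  have : 0 <= (t * (psi 1 - psi 0)) ^+ 2 * dot a a.
    by rewrite mulr_ge0 ?sqr_ge0 ?dot_ge0.
  by lra.
- by apply: le_trans Lub _; rewrite /G /lin; lra.
Qed.

End EuclideanPaths.

(** * The standard simplex and its faces *)

Section StandardSimplex.
Variables (R : realType) (k : nat).

Lemma corner_std (i : 'I_k.+1) : std_simplex (corner R i).
Proof.
split=> [j|]; first by rewrite mxE ler0n.
rewrite (bigD1 i) //= big1 => [|j ji]; rewrite mxE ?eqxx ?addr0 //.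
by rewrite (negPf ji) andbF.
Qed.

Lemma std_simplex_le1 (x : 'rV[R]_k.+1) i : std_simplex x -> x 0 i <= 1.
Proof.
by move=> [x0 <-]; rewrite (bigD1 i) //= lerDl sumr_ge0.
Qed.

Lemma std_simplex_other (x : 'rV[R]_k.+1) i j :
  std_simplex x -> j != i -> x 0 j <= 1 - x 0 i.
Proof.
move=> [x0 <-] ji; rewrite (bigD1 i) //= addrC addrK (bigD1 j) //=.
by rewrite lerDl sumr_ge0.
Qed.

Lemma sum_coface (G : 'I_k.+2 -> R -> R) (i : 'I_k.+2) (x : 'rV[R]_k.+1) :
  \sum_j G j (coface i x 0 j) = G i 0 + \sum_j G (lift i j) (x 0 j).
Proof.
rewrite (bigD1_ord i) //= mxE unlift_none; congr (_ + _).
by apply: eq_bigr => j _; rewrite mxE liftK.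
Qed.

Lemma coface_std (i : 'I_k.+2) (x : 'rV[R]_k.+1) :
  std_simplex x -> std_simplex (coface i x).
Proof.
move=> [x0 x1]; split=> [j|]; last by rewrite (sum_coface (fun=> id)) add0r.
by rewrite mxE; case: unliftP => /=.
Qed.

Lemma coface_corner (i : 'I_k.+2) (j : 'I_k.+1) :
  coface i (corner R j) = corner R (lift i j).
Proof.
apply/rowP => m; rewrite !mxE; case: unliftP => [m' ->|->] /=.
  by rewrite mxE (inj_eq (@lift_inj _ i)).
by rewrite (negPf (neq_lift _ _)).
Qed.

Lemma std_simplex_face (i : 'I_k.+2) (x : 'rV[R]_k.+2) :
  std_simplex x -> x 0 i = 0 ->
  exists2 y : 'rV[R]_k.+1, std_simplex y & x = coface i y.
Proof.
move=> [x0 x1] xi0; exists (\row_j x 0 (lift i j)).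
  split=> [j|]; first by rewrite mxE.
  rewrite -x1 (bigD1_ord i) //= xi0 add0r.
  by apply: eq_bigr => j _; rewrite mxE.
by apply/rowP => j; rewrite mxE; case: unliftP => [j' ->|->] /=; rewrite ?mxE.
Qed.

End StandardSimplex.

(** * Continuous functions on a triangulated space *)

Section Cells.
Variables (R : realType) (F : topologicalType) (tau : triangulation R F).
Implicit Types (v w : simp tau 0).

Lemma corner_open0 : open_std_simplex (corner R (0 : 'I_1)).
Proof.
split; last by have [] := corner_std R (0 : 'I_1).
by move=> i; rewrite ord1 mxE !eqxx ltr01.
Qed.

Lemma vertex_point_inj : injective (@vertex_point R F tau).
Proof.
move=> v w vw; have [c [_ cU]] := simp_bij tau (vertex_point v).
pose c0 (u : simp tau 0) : {k : nat & (simp tau k * 'rV[R]_k.+1)%type} :=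
  existT _ 0%N (u, corner R 0).
have cv : c = c0 v by apply: cU; split=> //; exact: corner_open0.
have cw : c = c0 w by apply: cU; split=> //; exact: corner_open0.
by move: (etrans (esym cv) cw) => /eqP; rewrite /c0 eq_Tagged /= => /eqP [].
Qed.

(** The value at p is read off from the open simplex that contains p.  That the
    formula extends to closed simplices follows by descending to faces, and
    continuity then holds because F is a quotient of its simplices. *)
Lemma glue_cells (T : topologicalType) (w : forall k, simp tau k -> 'rV[R]_k.+1 -> T) :
  (forall k (i : 'I_k.+2) (s : simp tau k.+1) x, std_simplex x ->
     w k (face i s) x = w k.+1 s (coface i x)) ->
  (forall k (s : simp tau k), continuous (w k s)) ->
  exists2 phi : F -> T, continuous phi &
    forall k (s : simp tau k) x, std_simplex x -> phi (cell s x) = w k s x.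
Proof.
move=> wface wcont.
pose c p := sval (cid (simp_bij tau p)).
have cU p d : open_std_simplex (tagged d).2 /\
    cell (tagged d).1 (tagged d).2 = p -> c p = d.
  by rewrite /c; case: cid => d' [/= _ +]; apply.
pose phi p := w _ (tagged (c p)).1 (tagged (c p)).2.
have phiE k (s : simp tau k) x : std_simplex x -> phi (cell s x) = w k s x.
  elim: k s x => [|k IH] s x xS.
    suff xO : open_std_simplex x.
      by rewrite /phi (cU _ (existT _ 0%N (s, x))).
    case: xS => x0 x1; split=> // i; rewrite ord1 -[0 : 'I_1]/ord0.
    by move: x1; rewrite big_ord1 => ->.
  have [xO|] := pselect (open_std_simplex x).
    by rewrite /phi (cU _ (existT _ k.+1 (s, x))).
  move=> nxO; have [i xi0] : exists i, x 0 i = 0.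
    apply: contrapT => nx; apply: nxO; case: xS => x0 x1; split=> // i.
    rewrite lt_neqAle x0 andbT eq_sym; apply/eqP => xi; apply: nx.
    by exists i.
  have [y yS xy] := std_simplex_face xS xi0.
  by rewrite xy -cell_face // IH // wface.
exists phi => //; apply/continuousP => U Uo.
apply/simp_open => k s; exists (w k s @^-1` U).
  by move/continuousP: (wcont k s); apply.
by apply/seteqP; split=> x [/= Ux xS]; split=> //; move: Ux; rewrite phiE.
Qed.

Lemma continuous_sum_coord k (g : 'I_k.+1 -> R -> R) :
  (forall i, continuous (g i)) ->
  continuous (fun x : 'rV[R]_k.+1 => \sum_i g i (x 0 i)).
Proof.
move=> gc; rewrite [X in continuous X](_ : _ = \sum_i fun x : 'rV[R]_k.+1 => g i (x 0 i)).
  apply: (big_ind (fun h => continuous h)) => [|h h' hc hc' x|i _ x].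
  - exact: cst_continuous.
  - exact: (continuousD (hc x) (hc' x)).
  - exact: (continuous_comp (@coord_continuous _ _ _ 0 i x) (gc i _)).
by apply/funext => x; rewrite fct_sumE.
Qed.

(** Several corners of one simplex may be glued to the same vertex, so the test
    is made corner by corner. *)
Definition at_vertex v k (s : simp tau k) (i : 'I_k.+1) : bool :=
  `[< cell s (corner R i) = vertex_point v >].

Lemma at_vertex_face v k (s : simp tau k.+1) i j :
  at_vertex v (face i s) j = at_vertex v s (lift i j).
Proof.
by rewrite /at_vertex cell_face ?coface_corner //; exact: corner_std.
Qed.

(** With g the identity, psi is the barycentric coordinate of v.  The condition
    g 0 = 0 is what makes the formula compatible with passing to a face. *)
Lemma hat_function v (g : R -> R) : continuous g -> g 0 = 0 ->
  exists2 psi : F -> R, continuous psi &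
    forall k (s : simp tau k) x, std_simplex x ->
      psi (cell s x) = \sum_(i | at_vertex v s i) g (x 0 i).
Proof.
move=> gc g0.
pose G k (s : simp tau k) (i : 'I_k.+1) r : R := if at_vertex v s i then g r else 0.
have [||psi psic psiE] := @glue_cells _ (fun k s x => \sum_i G k s i (x 0 i)).
- move=> k i s x xS; rewrite sum_coface /G g0 if_same add0r.
  by apply: eq_bigr => j _; rewrite at_vertex_face.
- move=> k s; apply: continuous_sum_coord => i; rewrite /G.
  by case: at_vertex => //; exact: cst_continuous.
exists psi => // k s x xS; rewrite psiE // [in RHS]big_mkcond /=.
by apply: eq_bigr => i _.
Qed.

Lemma at_vertex0 v w i : at_vertex v w i = (w == v).
Proof.
rewrite /at_vertex ord1 -[cell w _]/(vertex_point w).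
by apply/asboolP/eqP => [/vertex_point_inj|->].
Qed.

Lemma at_vertex_inj v w k (s : simp tau k) i :
  at_vertex v s i -> at_vertex w s i -> v = w.
Proof.
by move=> /asboolP vi /asboolP wi; apply: vertex_point_inj; rewrite -vi.
Qed.

Lemma corner_vertex k (s : simp tau k) i : exists v, at_vertex v s i.
Proof.
elim: k s i => [|k IH] s i; first by exists s; rewrite at_vertex0.
have [j ij] : exists j, j != i.
  by exists (lift i ord0); rewrite eq_sym neq_lift.
have [i' ii'] := unlift_some ij => _.
have [v] := IH (face j s) i'.
by rewrite at_vertex_face -ii'; exists v.
Qed.

(** The barycentric coordinate of v is 1 at v, and vanishes on simplices without
    a corner at v. *)
Lemma vertex_in_cell v k (s : simp tau k) :
  closed_cell s (vertex_point v) -> exists i, at_vertex v s i.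
Proof.
move=> [x xS sx].
have [psi _ psiE] := @hat_function v id (fun=> cvg_id) erefl.
apply: contrapT => nv.
have : psi (vertex_point v) = 0.
  rewrite -sx psiE // big1 // => i vi; case: nv; exists i; exact: vi.
rewrite psiE ?big_mkcond ?big_ord1 ?at_vertex0 ?eqxx; last exact: corner_std.
by rewrite mxE eqxx => /eqP; rewrite oner_eq0.
Qed.

(** * The star of a vertex *)

(** The face opposite to corner 0 is the end of e, the other one its start. *)
Definition joins v w (e : simp tau 1) : bool :=
  (face ord0 e == v) && (face ord_max e == w) ||
  (face ord0 e == w) && (face ord_max e == v).

(** As long as the simplex has a third corner, the face opposite to it still
    contains the two given corners. *)
Lemma joins_cell v w k (s : simp tau k) i j :
  i != j -> at_vertex v s i -> at_vertex w s j -> exists e, joins v w e.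
Proof.
case: k s i j => [|k] s i j; first by rewrite !ord1 eqxx.
elim: k s i j => [|k IH] s i j ij vi wj.
  exists s; rewrite /joins -!(at_vertex0 _ _ 0) !at_vertex_face.
  have -> : lift ord0 0 = ord_max :> 'I_2 by exact: val_inj.
  have -> : lift ord_max 0 = ord0 :> 'I_2 by exact: val_inj.
  have [i0|i1] := eqVneq i ord0.
    have j1 : j = ord_max.
      by apply: val_inj; move: ij; rewrite i0; case: (j) => -[|[]].
    by rewrite -i0 -j1 vi wj orbT.
  have {}i1 : i = ord_max.
    by apply: val_inj; move: i1; case: (i) => -[|[]].
  have j0 : j = ord0.
    by apply: val_inj; move: ij; rewrite i1; case: (j) => -[|[]].
  by rewrite -i1 -j0 vi wj.
have /card_gt0P[m] : (0 < #|~: [set i; j]|)%N.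
  by rewrite cardsCs finset.setCK card_ord cards2; case: (i != j).
rewrite !inE negb_or => /andP[mi mj].
have [i' ii'] := unlift_some mi => _; have [j' jj'] := unlift_some mj => _.
apply: (IH (face m s) i' j'); rewrite ?at_vertex_face -?ii' -?jj' //.
by apply: contraNneq ij => e; rewrite ii' jj' e.
Qed.

Lemma other_star_vertexE v w :
  other_star_vertex v w = (w != v) && [exists e, joins v w e].
Proof.
rewrite /other_star_vertex; case: eqVneq => //= wv.
apply/asboolP/existsP => [[k [s [/vertex_in_cell[i vi] /vertex_in_cell[j wj]]]]|].
  apply: (joins_cell _ vi wj); apply: contra_neq wv => ij.
  apply: (at_vertex_inj (i := j) wj); rewrite -ij; exact: vi.
have in_edge u (e : simp tau 1) m : face m e = u -> closed_cell e (vertex_point u).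
  move=> <-; exists (coface m (corner R 0)).
    exact/coface_std/corner_std.
  by rewrite -cell_face //; exact: corner_std.
move=> [e /orP[]/andP[/eqP e0 /eqP e1]]; exists 1%N, e; split.
- exact: in_edge e0.
- exact: in_edge e1.
- exact: in_edge e1.
- exact: in_edge e0.
Qed.

(** If v had no neighbour, each simplex would have all its corners at v or none,
    and the barycentric coordinate of v would be a continuous function onto
    {0, 1}. *)
Lemma exists_other_star_vertex v w0 :
  connected [set: F] -> w0 != v -> exists w, other_star_vertex v w.
Proof.
move=> connF w0v; apply: contrapT => no_w.
have [psi psic psiE] := @hat_function v id (fun=> cvg_id) erefl.
have psi_vertex u : psi (vertex_point u) = (u == v)%:R.
  rewrite psiE; last exact: corner_std.
  rewrite big_mkcond big_ord1 at_vertex0 mxE !eqxx.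
  by case: eqVneq.
have psi01 p : psi p = 0 \/ psi p = 1.
  have [c [[xO <-] _]] := simp_bij tau p.
  case: c xO => k [s x] /= [x0 x1].
  have xS : std_simplex x by split=> // i; exact: ltW.
  rewrite psiE //.
  have [[i vi]|nv] := pselect (exists i, at_vertex v s i); last first.
    by left; apply: big1 => i vi; case: nv; exists i.
  right; rewrite -x1; apply: eq_bigl => j.
  have [u uj] := corner_vertex s j.
  have [<- //|uv] := eqVneq u v.
  case: no_w; exists u; rewrite other_star_vertexE uv.
  apply/existsP/(joins_cell _ vi uj).
  by apply: contra_neq uv => ij; apply: (at_vertex_inj uj); rewrite -ij.
have /connected_intervalP itv : connected (psi @` [set: F]).
  by apply: connected_continuous_connected => //; exact: continuous_subspaceT.
have [|||p _ phalf] := itv 0 1 _ _ 2^-1.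
- by exists (vertex_point w0) => //; rewrite psi_vertex (negPf w0v).
- by exists (vertex_point v) => //; rewrite psi_vertex eqxx.
- by lra.
by case: (psi01 p); lra.
Qed.

(** Points with i-th coordinate close to 1 are close to the i-th corner, and
    only finitely many corners compete for the constant, as there are finitely
    many simplices in each dimension and none above dimension 2. *)
Lemma corner_cap v (U : set F) : open U -> U (vertex_point v) ->
  exists c : R, [/\ 0 < c, c < 1 &
    forall k (s : simp tau k) x i, std_simplex x -> at_vertex v s i ->
      c < x 0 i -> U (cell s x)].
Proof.
move=> /(@simp_open _ _ tau) Uo Uv.
have cap k : \forall c \near (1 : R)^'-, forall (s : simp tau k) (i : 'I_k.+1) x,
    std_simplex x -> at_vertex v s i -> c < x 0 i -> U (cell s x).
  apply: filter_forall => s; apply: filter_forall => i.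
  have [W Wo WE] := Uo k s.
  have [vi|/negP nvi] := boolP (at_vertex v s i); last first.
    by apply: nearW => c x.
  have /nbhs_ballP[d /= d0 dW] : nbhs (corner R i) W.
    apply: open_nbhs_nbhs; split=> //.
    have [] // : (W `&` @std_simplex R k) (corner R i).
    rewrite -WE; split; last exact: corner_std.
    by move/asboolP: vi => vi; rewrite /preimage /= vi.
  near=> c => x xS _ cx.
  have [] // : (cell s @^-1` U `&` @std_simplex R k) x.
  rewrite WE; split=> //; apply: dW; split=> // a j; rewrite ord1.
  have cd : 1 - c < d by near: c; exact: nbhs_left_ltBl.
  rewrite /ball /= mxE eqxx /=; have [->|ji] := eqVneq j i.
    rewrite ger0_norm ?subr_ge0 ?std_simplex_le1 //.
    by apply: lt_trans cd; rewrite ltrD2l ltrN2.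
  have := std_simplex_other xS ji; case: xS => x0 _.
  by rewrite sub0r normrN ger0_norm // => xj; lra.
have [c [c0 c1 cU]] : exists c : R, [/\ 0 < c, c < 1 & forall k, (k < 3)%N ->
    forall (s : simp tau k) (i : 'I_k.+1) x,
    std_simplex x -> at_vertex v s i -> c < x 0 i -> U (cell s x)].
  near (1 : R)^'- => c; exists c; split.
  - by near: c; exact: nbhs_left_gt.
  - by near: c; exact: nbhs_left_lt.
  - case=> [|[|[|//]]] _; near: c; exact: cap.
exists c; split=> // k s x i xS vi cx.
have [k3|k3] := ltnP k 3; first exact: cU vi cx.
case: k k3 s x i xS vi cx => [|[|[|k]]] // _ s.
by have := fintype0 s; rewrite simp_dim => /(_ erefl).
Unshelve. all: by end_near. Qed.

End Cells.

(** * The energy as a weighted sum of squared edge lengths *)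

Lemma sumr_gt0 (R : numDomainType) (I : finType) (P : pred I) (G : I -> R) i0 :
  P i0 -> 0 < G i0 -> (forall i, P i -> 0 <= G i) -> 0 < \sum_(i | P i) G i.
Proof.
move=> Pi0 Gi0 G0; rewrite (bigD1 i0) //= ltr_wpDr // sumr_ge0 //.
by move=> i /andP[/G0].
Qed.

Section Energy.
Variables (R : realType) (F : topologicalType) (tau : triangulation R F).
Variables (l : simp tau 1 -> R).
Hypothesis l_gt0 : forall e, 0 < l e.

(** The coefficient of L_e^2: each side of a triangle that lies on e contributes
    half the sum of the other two lengths, divided by the length of e. *)
Definition energy_weight (e : simp tau 1) : R :=
  \sum_(t : simp tau 2) \sum_(i < 3 | face i t == e)
    (\sum_(j < 3 | j != i) l (face j t)) / (2 * l e).

(** Positivity holds because every edge is a side of some triangle. *)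
Lemma energy_weight_gt0 e : 0 < energy_weight e.
Proof.
have [i0 [t0 fe]] := simp_face1 e.
have term_gt0 (t : simp tau 2) i :
    0 < (\sum_(j < 3 | j != i) l (face j t)) / (2 * l e).
  rewrite divr_gt0 ?mulr_gt0 // (@sumr_gt0 _ _ _ _ (lift i ord0)) //.
    by rewrite eq_sym neq_lift.
  by move=> j _; exact: ltW.
apply: (@sumr_gt0 _ _ _ _ t0) => // [|t _]; last by apply: sumr_ge0 => i _; exact: ltW.
by apply: (@sumr_gt0 _ _ _ _ i0) => [||i _]; rewrite ?fe ?eqxx // ltW.
Qed.

Lemma energyE n (f : F -> 'rV[R]_n) :
  energy l f = \sum_e energy_weight e * edge_length f e ^+ 2.
Proof.
transitivity (\sum_(t : simp tau 2) \sum_(i < 3)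
   (\sum_(j < 3 | j != i) l (face j t)) / (2 * l (face i t))
      * edge_length f (face i t) ^+ 2).
  rewrite /energy mulr_sumr; apply: eq_bigr => t _.
  rewrite !big_ord_recl big_ord0 !(big_mkcond (fun j => j != _)).
  rewrite !(big_mkcond (fun j : 'I__ => (_ < j)%N)) /= !big_ord_recl !big_ord0 /=.
  rewrite /stretch.
  have l0 i : l (face i t) != 0 by rewrite gt_eqF.
  by field; rewrite !l0.
transitivity (\sum_(t : simp tau 2) \sum_e \sum_(i < 3 | face i t == e)
   (\sum_(j < 3 | j != i) l (face j t)) / (2 * l e) * edge_length f e ^+ 2).
  apply: eq_bigr => t _; rewrite (partition_big (fun i => face i t) predT) //=.
  by apply: eq_bigr => e _; apply: eq_bigr => i /eqP ->.
rewrite exchange_big; apply: eq_bigr => e _; rewrite mulr_suml.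
by apply: eq_bigr => t _; rewrite mulr_suml.
Qed.

End Energy.

(** * Squeezed derivatives and weighted means *)

Lemma derive_quadratic_remainder (R : realType) (E : R -> R) (D K : R) :
  (forall t, E 0 + t * D <= E t <= E 0 + t * D + t ^+ 2 * K) ->
  derivable E 0 1 /\ 'D_1 E 0 = D.
Proof.
move=> EB.
have lim : h^-1 *: ((E \o shift 0) (h *: 1) - E 0) @[h --> (0 : R)^'] --> D.
  apply/cvgrPdist_le => e e0; near=> h.
  have h0 : h != 0 by near: h; exact: nbhs_dnbhs_neq.
  have hK : `|h| <= e / (`|K| + 1).
    by near: h; apply: dnbhs0_le; rewrite divr_gt0 // ltr_wpDl.
  rewrite /= /shift /= addr0 [h *: _]mulr1.
  have -> : D - h^-1 *: (E h - E 0) = - (h^-1 * (E h - E 0 - h * D)).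
    by rewrite /GRing.scale /=; field.
  have /andP[E1 E2] := EB h.
  rewrite normrN normrM normfV ler_pdivrMl ?normr_gt0 //.
  rewrite ger0_norm; last by lra.
  have K1 : 0 < `|K| + 1 by rewrite ltr_wpDl.
  rewrite ler_pdivlMr // in hK.
  have KK : K <= `|K| := ler_norm K.
  have hh : h ^+ 2 = `|h| ^+ 2 by rewrite real_normK ?num_real.
  have : `|h| * (`|h| * (`|K| + 1)) <= `|h| * e by rewrite ler_wpM2l.
  have : `|h| ^+ 2 * K <= `|h| ^+ 2 * `|K| by rewrite ler_wpM2l ?sqr_ge0.
  by rewrite hh in E2; have := sqr_ge0 `|h|; lra.
split; first by apply/cvg_ex; exists D.
exact: cvg_lim lim.
Unshelve. all: by end_near. Qed.

Lemma convex_hull_weighted_mean (R : realType) (n : nat) (A : set 'rV[R]_n)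
    (I : finType) (P : pred I) (m : I -> R) (x : I -> 'rV[R]_n) :
  (forall i, P i -> 0 <= m i) -> (forall i, P i -> A (x i)) ->
  0 < \sum_(i | P i) m i ->
  convex_hull A ((\sum_(i | P i) m i)^-1 *: \sum_(i | P i) m i *: x i).
Proof.
move=> m0 xA M0 C [Cconv AC].
suff H (s : seq I) : 0 < \sum_(i <- s | P i) m i ->
    C ((\sum_(i <- s | P i) m i)^-1 *: \sum_(i <- s | P i) m i *: x i).
  exact: H.
elim: s => [|i s IH]; first by rewrite !big_nil ltxx.
rewrite !big_cons; case: ifP => // Pi.
set M := \sum_(j <- s | P j) m j; set X := \sum_(j <- s | P j) m j *: x j.
have : 0 <= M by apply: sumr_ge0.
rewrite le_eqVlt => /predU1P[M00|Mpos] miM.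
  (* The remaining weights may all be 0, and then cannot be normalised. *)
  have /allP m_eq0 : all (fun j => P j ==> (m j == 0)) s.
    by rewrite -psumr_eq0 // -/M -M00.
  have X0 : X = 0.
    rewrite /X big_seq_cond; apply: big1 => j /andP[/m_eq0 + Pj].
    by rewrite Pj => /eqP ->; rewrite scale0r.
  rewrite -M00 X0 !addr0 in miM *; rewrite scalerA.
  rewrite mulVf; last by rewrite gt_eqF.
  by rewrite scale1r; exact/AC/xA.
have lam0 : 0 <= m i / (m i + M) by rewrite divr_ge0 ?m0 // ltW.
have lam1 : m i / (m i + M) <= 1 by rewrite ler_pdivrMr // mul1r lerDl ltW.
have := Cconv (x i) (M^-1 *: X) (Itv01 lam0 lam1).
rewrite !inE => /(_ (AC _ (xA _ Pi)) (IH Mpos)); congr C.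
rewrite /conv /= scalerDr !scalerA; congr (_ *: _ + _ *: _).
  by rewrite mulrC.
by rewrite /unstable.onem; field; rewrite !gt_eqF.
Qed.

(** * Balance of an interior vertex *)

Section Balance.
Variables (R : realType) (F : topologicalType) (tau : triangulation R F).

Lemma edge_start (e : simp tau 1) : cell e (corner R 0) = vertex_point (face ord_max e).
Proof.
rewrite /vertex_point cell_face ?coface_corner; last exact: corner_std.
by congr (cell e (corner R _)); exact: val_inj.
Qed.

Lemma edge_end (e : simp tau 1) : cell e (corner R 1) = vertex_point (face ord0 e).
Proof.
rewrite /vertex_point cell_face ?coface_corner; last exact: corner_std.
by congr (cell e (corner R _)); exact: val_inj.
Qed.

Lemma segment_coord (s : R) (i : 'I_2) :
  segment (corner R 0) (corner R 1) s 0 i = if i == ord0 then 1 - s else s.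
Proof.
rewrite !mxE eqxx /=; case: eqVneq => [->|i0] /=; first by rewrite mulr1 mulr0 addr0.
have -> : i = 1 by apply: val_inj; move: i0; case: (i) => -[|[]].
by rewrite eqxx mulr0 mulr1 add0r.
Qed.

Lemma segment_std (s : R) : 0 <= s <= 1 ->
  std_simplex (segment (corner R (0 : 'I_2)) (corner R 1) s).
Proof.
move=> s01; split=> [i|].
  by rewrite segment_coord; case: ifP => _; lra.
by rewrite big_ord_recl big_ord1 !segment_coord /= subrK.
Qed.

Definition clip (c r : R) : R := Num.max 0 (r - c).

Lemma clip_continuous c : continuous (clip c).
Proof.
move=> r; apply: (@continuous_max _ _ (fun=> 0) (fun r => r - c)).
  exact: cst_continuous.
by apply: continuousB; [exact: cvg_id|exact: cst_continuous].
Qed.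

Lemma clip_lipschitz c r r' : `|clip c r' - clip c r| <= `|r' - r|.
Proof.
rewrite /clip ler_norml.
have up := ler_norm (r' - r); have := ler_norm (- (r' - r)); rewrite normrN => lo.
by case: (leP 0 (r - c)) => rc; case: (leP 0 (r' - c)) => r'c; apply/andP; split; lra.
Qed.

(** The signed count of the ends of e at v; it vanishes on loops, whose length
    does not change to first order when v is moved. *)
Definition incidence (v : simp tau 0) (e : simp tau 1) : R :=
  (face ord0 e == v)%:R - (face ord_max e == v)%:R.

Lemma sum_at_vertex_edge v (e : simp tau 1) (G : 'I_2 -> R) :
  \sum_(i | at_vertex v e i) G i =
  (face ord_max e == v)%:R * G ord0 + (face ord0 e == v)%:R * G ord_max.
Proof.
rewrite big_mkcond big_ord_recl big_ord1.
have -> : at_vertex v e ord0 = (face ord_max e == v).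
  by rewrite -(at_vertex0 _ _ 0) at_vertex_face; congr at_vertex; exact: val_inj.
have -> : lift ord0 ord0 = ord_max :> 'I_2 by exact: val_inj.
have -> : at_vertex v e ord_max = (face ord0 e == v).
  by rewrite -(at_vertex0 _ _ 0) at_vertex_face; congr at_vertex; exact: val_inj.
by do 2!case: eqP => _; rewrite ?mul1r ?mul0r.
Qed.

(** The bump is the sum of max(0, x - c) over the coordinates x at the corners
    at v, with c < 1 such that the caps x > c lie in a neighbourhood of v made
    of interior points.  Along an edge it is a sum of at most two 1-Lipschitz
    functions, and kappa = 1 - c is its value at v. *)
Lemma interior_vertex_bump v : ~ surface_boundary R (vertex_point v) ->
  exists (psi : F -> R) (kappa : R),
    [/\ 0 < kappa, continuous psi,
        forall p, surface_boundary R p -> psi p = 0 &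
        forall e : simp tau 1,
          let psi_e s := psi (cell e (segment (corner R 0) (corner R 1) s)) in
          (forall r r', 0 <= r -> r <= r' -> r' <= 1 ->
             `|psi_e r' - psi_e r| <= 2 * (r' - r)) /\
          psi_e 1 - psi_e 0 = kappa * incidence v e].
Proof.
move=> /contrapT[U [W [Uo Uv Wo UW]]].
have [c [c0 c1 cU]] := corner_cap Uo Uv.
have clip0 : clip c 0 = 0 by rewrite /clip sub0r; apply/max_idPl; lra.
have clip1 : clip c 1 = 1 - c by rewrite /clip; apply/max_idPr; lra.
have [psi psic psiE] := @hat_function _ _ tau v _ (@clip_continuous c) clip0.
exists psi, (1 - c); split=> //; first by rewrite subr_gt0.
  move=> p bp; have [d [[dO dp] _]] := simp_bij tau p.
  case: d dO dp => k [s x] /= [x0 x1] sx.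
  have xS : std_simplex x by split=> // i; exact: ltW.
  rewrite -sx psiE //; apply: big1 => i vi.
  have [cx|xc] := ltP c (x 0 i); last by apply/max_idPl; lra.
  by case: bp; exists U, W; split=> //; rewrite -sx; exact: cU cx.
move=> e psi_e.
have psi_eE s : 0 <= s <= 1 -> psi_e s =
    (face ord_max e == v)%:R * clip c (1 - s) + (face ord0 e == v)%:R * clip c s.
  move=> s01; rewrite /psi_e psiE; last exact: segment_std.
  by rewrite sum_at_vertex_edge !segment_coord.
split; last first.
  by rewrite !psi_eE ?lexx ?ler01 // subrr subr0 clip0 clip1 /incidence; ring.
move=> r r' r0 rr' r1; rewrite !psi_eE ?r0 ?r1 ?(le_trans r0) ?(le_trans rr') //.
have l1 := clip_lipschitz c (1 - r) (1 - r').
have l2 := clip_lipschitz c r r'.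
rewrite (ger0_norm (_ : 0 <= r' - r)) ?subr_ge0 // in l2.
rewrite (_ : 1 - r' - (1 - r) = - (r' - r)) ?normrN in l1; last by ring.
rewrite (ger0_norm (_ : 0 <= r' - r)) ?subr_ge0 // in l1.
rewrite ler_norml in l1; rewrite ler_norml in l2; rewrite ler_norml.
by do 2!case: eqP => _; rewrite /= ?mul1r ?mul0r; lra.
Qed.

(** The variation moves f with velocity psi Z, where psi is the bump at v and Z
    is the vector claimed to vanish.  The derivative of the energy is then a
    positive multiple of the squared norm of Z. *)
Lemma harmonic_balance (l : simp tau 1 -> R) n (f : F -> 'rV[R]_n) v :
  (forall e, 0 < l e) -> simplicial_harmonic l f ->
  ~ surface_boundary R (vertex_point v) ->
  \sum_e (energy_weight l e * incidence v e) *: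
     (f (vertex_point (face ord0 e)) - f (vertex_point (face ord_max e))) = 0.
Proof.
move=> l0 [[fc fe _] f_crit] v_int.
have [psi [kappa [kappa0 psic psi_bd psi_edge]]] := interior_vertex_bump v_int.
pose u (e : simp tau 1) : 'rV[R]_n :=
  f (vertex_point (face ord0 e)) - f (vertex_point (face ord_max e)).
set Z := \sum_e _; apply: dot_eq0.
pose h (t : R) (p : F) : 'rV[R]_n := f p + (t * psi p) *: Z.
have hL t e : let lin := dot (u e) (u e) +
      t * (2 * (kappa * incidence v e) * dot (u e) Z) in
    [/\ (path_length (edge_path (h t) e) < +oo)%E,
        lin <= edge_length (h t) e ^+ 2 &
        edge_length (h t) e ^+ 2 <= lin + t ^+ 2 * (2 ^+ 2 * dot Z Z)].
  have [psi_lip psi_end] := psi_edge e.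
  rewrite /= -psi_end; apply: perturbed_segment_length psi_lip.
  move=> s s01; rewrite /edge_path /h; congr (_ + _).
  rewrite -edge_end -edge_start.
  have := fe e s s01; rewrite /edge_path => ->.
  congr (segment (f (cell e _)) (f (cell e _)) s).
    by rewrite /segment subr0 scale0r addr0 scale1r.
  by rewrite /segment subrr scale0r add0r scale1r.
pose D := \sum_e energy_weight l e * (2 * (kappa * incidence v e) * dot (u e) Z).
pose K := \sum_e energy_weight l e * (2 ^+ 2 * dot Z Z).
have w0 e : 0 <= energy_weight l e by exact/ltW/energy_weight_gt0.
have E0 : energy l (h 0) = \sum_e energy_weight l e * dot (u e) (u e).
  rewrite energyE //; apply: eq_bigr => e _; congr (_ * _).
  have [_ lo hi] := hL 0 e.
  by apply: le_anti; move: lo hi; rewrite expr0n /= !mul0r !addr0 => -> ->.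
have EB t : energy l (h 0) + t * D <= energy l (h t) <=
    energy l (h 0) + t * D + t ^+ 2 * K.
  rewrite E0 energyE // /D /K [t * _]mulr_sumr [t ^+ 2 * _]mulr_sumr.
  rewrite -!big_split /=.
  apply/andP; split; apply: ler_sum => e _; have [_ lo hi] := hL t e.
    by have := ler_wpM2l (w0 e) lo; lra.
  by have := ler_wpM2l (w0 e) hi; lra.
have [Ed ED] := derive_quadratic_remainder EB.
have D0 : D = 0.
  rewrite -ED; apply: (f_crit 1) => //.
  - split=> //.
    + by apply/funext => p; rewrite /h mul0r scale0r addr0.
    + apply: continuous_subspaceT => p; rewrite /h.
      apply: cvgD; first exact: (continuous_comp cvg_snd (fc _)).
      apply: cvgZr_tmp; apply: cvgM; first exact: cvg_fst.
      exact: (continuous_comp cvg_snd (psic _)).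
    + by move=> t _ e; have [] := hL t e.
  - by move=> t p _ bp; rewrite /h psi_bd // mulr0 scale0r addr0.
have DZ : D = 2 * kappa * dot Z Z.
  rewrite [in RHS]/Z dot_suml mulr_sumr; apply: eq_bigr => e _.
  by rewrite dotZl -/(u e); ring.
move/eqP: D0; rewrite DZ mulf_eq0 => /predU1P[|/eqP //].
by move=> /eqP; rewrite mulf_eq0 pnatr_eq0 /= gt_eqF.
Qed.

End Balance.

Theorem lemma6p1 (R : realType) (F : topologicalType)
    (surfF : compact_surface R F) (connF : connected [set: F])
    (tau : triangulation R F) (l : simp tau 1 -> R)
    (metric_l : simplicial_metric l)
    (n : nat) (f : F -> 'rV[R]_n) (harm_f : simplicial_harmonic l f)
    (v : simp tau 0)
    (v_interior : ~ surface_boundary R (vertex_point v))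
    (v_not_alone : exists w : simp tau 0, w != v) :
  convex_hull [set f (vertex_point w) | w in [set w | other_star_vertex v w]]
    (f (vertex_point v)) /\
  exists m : simp tau 0 -> R,
    (forall w, other_star_vertex v w -> 0 < m w) /\
    f (vertex_point v) =
      (\sum_(w | other_star_vertex v w) m w)^-1 *:
        \sum_(w | other_star_vertex v w) m w *: f (vertex_point w).
Proof.
have l0 : forall e, 0 < l e by case: metric_l.
pose x (w : simp tau 0) := f (vertex_point w).
pose m w := \sum_(e | joins v w e) energy_weight l e.
have m_gt0 w : other_star_vertex v w -> 0 < m w.
  rewrite other_star_vertexE => /andP[_ /existsP[e vwe]].
  by apply: (@sumr_gt0 _ _ _ _ e) => // [|e' _]; rewrite ?ltW ?energy_weight_gt0.
have M_gt0 : 0 < \sum_(w | other_star_vertex v w) m w.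
  have [w0 w0v] := v_not_alone.
  have [w vw] := exists_other_star_vertex connF w0v.
  by apply: (@sumr_gt0 _ _ _ _ w) => // [|w' vw']; rewrite ?ltW ?m_gt0.
have balance : \sum_(w | other_star_vertex v w) m w *: (x v - x w) = 0.
  apply: etrans (harmonic_balance l0 harm_f v_interior).
  transitivity (\sum_w \sum_(e | (w != v) && joins v w e)
      energy_weight l e *: (x v - x w)).
    rewrite big_mkcond; apply: eq_bigr => w _; rewrite other_star_vertexE.
    case: eqVneq => /= [_|wv]; first by rewrite big_pred0.
    case: ifPn => [_|/existsPn nvw]; first by rewrite scaler_suml.
    by rewrite big_pred0 // => e; exact: negbTE (nvw e).
  (* Each edge at v has at most one other end, so it contributes one term. *)
  rewrite (exchange_big_dep predT) //=; apply: eq_bigr => e _.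
  rewrite /incidence /joins -!/(x _).
  set a := face ord0 e; set b := face ord_max e.
  have [av|av] := eqVneq a v; have [bv|bv] := eqVneq b v.
  - rewrite subrr mulr0 scale0r big_pred0 // av bv => w.
    by rewrite ![v == w]eq_sym andbT orbb andNb.
  - rewrite (big_pred1 b) => [|w]; last first.
      by rewrite /= andbF orbF [b == w]eq_sym; case: (eqVneq w b) => [->|_];
         rewrite ?bv ?andbF.
    by rewrite subr0 mulr1 av.
  - rewrite (big_pred1 a) => [|w]; last first.
      by rewrite /= andbT [a == w]eq_sym; case: (eqVneq w a) => [->|_];
         rewrite ?av ?andbF.
    by rewrite sub0r mulrN1 scaleNr -scalerN opprB bv.
  - rewrite subrr mulr0 scale0r big_pred0 // => w.
    by rewrite /= andbF andbF.
have mean : x v = (\sum_(w | other_star_vertex v w) m w)^-1 *: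
    \sum_(w | other_star_vertex v w) m w *: x w.
  suff <- : (\sum_(w | other_star_vertex v w) m w) *: x v =
      \sum_(w | other_star_vertex v w) m w *: x w.
    by rewrite scalerA mulVf ?scale1r // gt_eqF.
  apply/eqP; rewrite scaler_suml -subr_eq0 -sumrB -[X in _ == X]balance.
  by apply/eqP; apply: eq_bigr => w _; rewrite scalerBr.
split; last by exists m.
rewrite -/(x v) mean; apply: convex_hull_weighted_mean => // [w vw|w vw].
  exact/ltW/m_gt0.
by exists w.
Qed.
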